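(* Let $\nu$ be a probability measure on $\mathbb{R}$ with a $C^1$ density $\lambda$ (with respect to Lebesgue measure). Assume that $\lambda(z)>0$ for all $z\in\mathbb{R}$, that $\lim_{|z|\to\infty}\lambda(z)=0$, and that $\lambda'$ is bounded. Let $A\subset\mathbb{R}^n$ be a monotone set (either increasing or decreasing). Then $$\lim_{r\downarrow 0}\frac{\nu^{\otimes n}(A+[-r,r]^n)-\nu^{\otimes n}(A)}{r}=\sum_{i=1}^n I_i^{\mathcal G}(A),$$ where the geometric influences $I_i^{\mathcal G}(A)$ are taken with respect to $\nu^{\otimes n}$.
   Context: A set $A\subseteq\mathbb{R}^n$ is monotone increasing if $x\in A$ and $y_j\ge x_j$ for all $j$ imply $y\in A$; it is monotone decreasing if $x\in A$ and $y_j\le x_j$ for all $j$ imply $y\in A$. $A+B$ denotes the Minkowski sum. Geometric influence: for a probability measure $\nu$ on $\mathbb{R}$ and a measurable $S\subseteq\mathbb{R}$, the lower Minkowski content is $\nu^+(S)=\liminf_{r\downarrow 0}\frac{\nu(S+[-r,r])-\nu(S)}{r}$. For $A\subseteq\mathbb{R}^n$, $x\in\mathbb{R}^n$ and $1\le i\le n$, let $A_i^x=\{y\in\mathbb{R}:(x_1,\dots,x_{i-1},y,x_{i+1},\dots,x_n)\in A\}$. The geometric influence of the $i$th coordinate on $A$ (with respect to $\nu^{\otimes n}$) is $I_i^{\mathcal G}(A)=\mathbb{E}_{x\sim\nu^{\otimes n}}[\nu^+(A_i^x)]$. *)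

(* Defs.v *)
From HB Require Import structures.
From mathcomp Require Import all_boot all_order all_algebra.
From mathcomp Require Import all_classical all_reals all_analysis.

Set Implicit Arguments.
Unset Strict Implicit.
Unset Printing Implicit Defensive.
Import Order.TTheory GRing.Theory Num.Theory.
Import numFieldNormedType.Exports.
Local Open Scope classical_set_scope.
Local Open Scope ring_scope.

Section power_measure.
Context d (T : measurableType d) (R : realType) (P : probability T R).

Definition tuple_cons n (p : T * n.-tuple T) : n.+1.-tuple T :=
  [the n.+1.-tuple T of p.1 :: p.2].

Lemma measurable_tuple_cons n : measurable_fun setT (@tuple_cons n).
Proof. exact: measurable_cons. Qed.

HB.instance Definition _ n := isMeasurableFun.Build _ _ _ _ (@tuple_cons n)
  (@measurable_tuple_cons n).

Fixpoint power_measure n : probability (n.-tuple T) R :=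
  if n isn't m.+1 then [the probability _ _ of \d_([tuple] : 0.-tuple T)]
  else [the probability _ _ of
    distribution [the probability _ _ of (P \x power_measure m)%E]
                 [the {mfun _ >-> _} of @tuple_cons m]].

Lemma power_measure_box n (B : 'I_n -> set T) :
  (forall i, measurable (B i)) ->
  (power_measure n [set x | forall i, B i (tnth x i)] = \prod_(i < n) P (B i))%E.
Proof.
elim: n B => [|n IH] B mB.
  by rewrite big_ord0 /= diracE mem_set // => -[].
rewrite big_ord_recl /= /distribution /pushforward.
rewrite [X in (_ \x _)%E X](_ : _ = B ord0 `*`
   [set x : n.-tuple T | forall i : 'I_n, B (lift ord0 i) (tnth x i)]); last first.
  apply/seteqP; split => [[a x] /= h|[a x] /= [h1 h2] i].
    split; first exact: (h ord0).
    by move=> i; have := h (lift ord0 i); rewrite tnthS.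
  by case: (unliftP ord0 i) => [j ->|->] //; rewrite tnthS.
rewrite product_measure1E //.
  by congr mule; exact: (IH (fun j => B (lift ord0 j))).
have -> : [set x : n.-tuple T | forall i : 'I_n, B (lift ord0 i) (tnth x i)] =
    \bigcap_(i in [set: 'I_n]) ((fun x => tnth x i) @^-1` B (lift ord0 i)).
  by apply/seteqP; split => x /= h i; [move=> _; exact: h | exact: (h i I)].
apply: fin_bigcap_measurable => [|i _]; first exact: finite_finset.
rewrite -[X in measurable X]setTI.
exact: measurable_tnth.
Qed.

End power_measure.

Section minkowski.
Context (R : realType).
Implicit Types (S : set R) (r : R).

Definition minkowski_sum S1 S2 : set R := [set x + y | x in S1 & y in S2].

Definition minkowski_content (nu : set R -> \bar R) S : \bar R :=
  limf_einf (fun r => (nu (minkowski_sum S `[(- r)%R, r]) - nu S) / r%:E)%E 0^'+.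

Context (n : nat).
Implicit Types (x y : n.-tuple R) (A : set (n.-tuple R)).

Definition tuple_add x y : n.-tuple R := [tuple tnth x i + tnth y i | i < n].

Definition tuple_minkowski_sum A1 A2 : set (n.-tuple R) :=
  [set tuple_add x y | x in A1 & y in A2].

Definition cube r : set (n.-tuple R) := [set x | forall i, tnth x i \in `[- r, r]].

Definition monotone_increasing A :=
  forall x y, A x -> (forall j, tnth x j <= tnth y j) -> A y.

Definition monotone_decreasing A :=
  forall x y, A x -> (forall j, tnth y j <= tnth x j) -> A y.

Definition fiber A x (i : 'I_n) : set R :=
  [set y | A [tuple if j == i then y else tnth x j | j < n]].

End minkowski.

Section geometric_influence.
Context (R : realType) (nu : probability (measurableTypeR R) R) (n : nat).

(* For n >= 2 a monotone set need not be Borel (take {x | \sum_i x_i > 0} plus a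
   non-Borel part of {x | \sum_i x_i = 0}), but it is Lebesgue measurable, hence
   measurable for the completion of a product measure that has a density. *)
Definition completed_power_measure :
    {measure set (caratheodory_type (power_measure nu n)^*%mu) -> \bar R} :=
  @completed_measure_extension _ _ _ (power_measure nu n).

Definition geometric_influence (A : set (n.-tuple R)) (i : 'I_n) : \bar R :=
  (\int[completed_power_measure]_x minkowski_content nu (fiber A x i))%E.

End geometric_influence.

(* Main.v *)
(* Since A is monotone, A + [-r,r]^n is the translate of A by r along plus or
   minus the diagonal.  Translating one coordinate at a time writes the increment
   of the measure as a sum over k of integrals of (nu(A_k^x + shift) - nu(A_k^x)),
   taken at a point x whose first k coordinates have already been moved.  The
   fibres are half-lines, so these quotients by r are bounded by sup lambda and
   converge to nu^+(A_k^x); displacing x by O(r) changes the integral of a bounded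
   function by at most a multiple of the total variation distance between nu and
   its translate, which vanishes with r.  Dominated convergence concludes.

   For a non-Borel A, the union B of the orthants with a rational corner in A is
   Borel, monotone, contained in A, and A lies in every small diagonal translate
   of B; hence A and B differ by a null set, and so do almost all their fibres. *)
Require Import Defs.
From HB Require Import structures.
From mathcomp Require Import all_boot all_order all_algebra.
From mathcomp Require Import all_classical all_reals all_analysis.
From mathcomp Require Import measurable_realfun ring lra.

Set Implicit Arguments.
Unset Strict Implicit.
Unset Printing Implicit Defensive.
Import Order.TTheory GRing.Theory Num.Theory.
Import numFieldNormedType.Exports.
Local Open Scope classical_set_scope.
Local Open Scope ring_scope.

(** * Translations of a density *)

Section lebesgue_translation.
Context (R : realType).
Implicit Types (s : R) (S : set R).

Lemma measurable_addr s : measurable_fun [set: R] (fun z : R => z + s).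
Proof. exact: measurable_funD. Qed.

Lemma measurable_preimage_addr s S :
  measurable S -> measurable ((fun z : R => z + s) @^-1` S).
Proof.
by move=> mS; rewrite -[X in measurable X]setTI; exact: measurable_addr.
Qed.

(** The pushforward of Lebesgue measure under [z + s] gives every half-open interval its length, and
    Lebesgue measure is the only measure that does. *)
Lemma lebesgue_measure_addr s S : measurable S ->
  lebesgue_measure ((fun z : R => z + s) @^-1` S) = lebesgue_measure S.
Proof.
move=> mS; pose f : measurableTypeR R -> measurableTypeR R := fun z => z + s.
have mf : measurable_fun setT f by exact: measurable_addr.
pose fm : {mfun _ >-> _} := HB.pack f (isMeasurableFun.Build _ _ _ _ _ mf).
rewrite [RHS](@lebesgue_measure_unique R (pushforward lebesgue_measure fm))//.
move=> _ [[a b] _ <-].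
transitivity (lebesgue_measure `]a - s, b - s]%classic); last first.
  congr lebesgue_measure.
  by apply/seteqP; split => z /=; rewrite !in_itv/= ltrBlDr lerBrDr.
rewrite !lebesgue_measure_itv/= !lte_fin ltrD2r; case: ifP => // _.
by rewrite -!EFinB opprB addrA subrK.
Qed.

Lemma ge0_integral_addr s (f : R -> \bar R) :
  measurable_fun setT f -> (forall z, 0 <= f z)%E ->
  (\int[@lebesgue_measure R]_z f ((z : R) + s)%R =
   \int[@lebesgue_measure R]_z f z)%E.
Proof.
move=> mf f0.
rewrite -[LHS](@ge0_integral_pushforward _ _ (measurableTypeR R)
  (measurableTypeR R) R (fun z => z + s) (measurable_addr s) _ setT f)//.
apply: eq_measure_integral; first exact: measurable_addr.
by move=> ? S mS _; exact: (lebesgue_measure_addr s mS).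
Qed.

End lebesgue_translation.

(** Having a density makes [P] absolutely continuous. Its Radon-Nikodym derivative and [f] have the
    same integral over every measurable set, hence agree almost everywhere, so the change of
    variables for the derivative holds for [f]. *)
Lemma integral_density d (T : measurableType d) (R : realType)
    (mu : {sigma_finite_measure set T -> \bar R})
    (P : {finite_measure set T -> \bar R}) (f : T -> R) (H : T -> \bar R) :
  measurable_fun setT f ->
  (forall S, measurable S -> P S = (\int[mu]_(z in S) (f z)%:E)%E) ->
  P.-integrable setT H ->
  (\int[P]_z H z = \int[mu]_z (H z * (f z)%:E))%E.
Proof.
move=> mf Pf iH.
have Pmu : P `<< mu.
  apply/null_content_dominatesP => S mS; rewrite Pf//.
  move=> S0; apply: null_set_integral => //.
  exact/measurable_funTS/measurable_EFinP.
rewrite -(Radon_Nikodym_change_of_variables Pmu)//=.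
have mH := measurable_int _ iH.
have iRN : mu.-integrable setT (Radon_Nikodym (charge_of_finite_measure P) mu).
  by apply: Radon_Nikodym_integrable; exact: Pmu.
apply: ae_eq_integral => //.
- by apply: emeasurable_funM => //; exact: measurable_int iRN.
- by apply: emeasurable_funM => //; exact/measurable_EFinP.
apply: ae_eqe_mul2l; apply: integral_ae_eq => //.
- exact/measurable_EFinP.
- by move=> S _ mS; rewrite -Pf// -Radon_Nikodym_integral.
Qed.

(** For the upper bound, every set of the filter meets [f x < l + e], so its infimum is at most
    [l + e]. For the lower bound, the set where [l - e < f x] belongs to the filter and competes in
    the supremum. *)
Lemma cvg_limf_einf (T : choiceType) (X : filteredType T) (R : realType)
    (F : set_system X) (f : X -> \bar R) (l : R) : ProperFilter F ->
  f x @[x --> F] --> l%:E -> limf_einf f F = l%:E.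
Proof.
move=> PF fl; rewrite limf_einfE; apply/eqP; rewrite eq_le; apply/andP; split.
  apply/lee_addgt0Pr => e e0; apply: ge_ereal_sup => _ [V FV <-].
  have le : (l%:E < (l + e)%:E)%E by rewrite lte_fin ltrDl.
  have Fe : F (f @^-1` [set x | x < (l + e)%:E]%E).
    by apply: fl; exact: (open_ereal_lt' le).
  have /filter_ex[x [Vx fx]] : F (V `&` f @^-1` [set x | x < (l + e)%:E]%E).
    exact: filterI.
  by rewrite -EFinD (le_trans _ (ltW fx))//; apply: ereal_inf_lbound; exists x.
apply/lee_subgt0Pr => e e0.
have le : ((l - e)%:E < l%:E)%E by rewrite lte_fin ltrBlDr ltrDl.
have Fe : F (f @^-1` [set x | (l - e)%:E < x]%E).
  by apply: fl; exact: (open_ereal_gt' le).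
apply: (@le_trans _ _ (ereal_inf (f @` [set x | ((l - e)%:E < f x)%E]))).
  by apply: le_ereal_inf_tmp => _ [x /= fx <-]; rewrite -EFinB ltW.
by apply: ereal_sup_ubound; exists [set x | ((l - e)%:E < f x)%E].
Qed.

(** * Effect of a translation on a measure with a continuous positive density *)

Section density_translation.
Context (R : realType) (nu : probability (measurableTypeR R) R) (lambda : R -> R).
Hypotheses (nu_density : forall B : set (measurableTypeR R), measurable B ->
       nu B = (\int[lebesgue_measure]_(z in B) (lambda z)%:E)%E)
  (lambda_cont : continuous lambda) (lambda_gt0 : forall z, 0 < lambda z).
Local Notation leb := (@lebesgue_measure R).

Let mlambda : measurable_fun [set: R] lambda.
Proof. exact: continuous_measurable_fun. Qed.

Let integrable_lambda : leb.-integrable setT (EFin \o lambda).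
Proof.
apply/integrableP; split; first exact/measurable_EFinP.
under eq_integral do rewrite /= gtr0_norm//.
by rewrite -nu_density// probability_setT ltry.
Qed.

(* The total variation distance between nu and its translate by s. *)
Definition translation_gap (s : R) : \bar R :=
  (\int[leb]_z (Num.max (lambda z - lambda ((z : R) + s)%R) 0)%:E)%E.

Lemma translation_gap_ge0 s : (0 <= translation_gap s)%E.
Proof. by apply: integral_ge0 => z _; rewrite lee_fin le_max lexx orbT. Qed.

Let measurable_gap s :
  measurable_fun [set: R] (fun z : R => Num.max (lambda z - lambda (z + s)) 0).
Proof.
apply: measurable_maxr => //; apply: measurable_funB => //.
by apply: measurableT_comp => //; exact: measurable_addr.
Qed.

(** Against Lebesgue measure, replacing the weight [lambda z] by [lambda (z + s)] turns the left
    side into the integral of [H], by translation invariance. The replacement costs at most [M]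
    times the positive part of the difference of the weights. *)
Lemma integral_addr_le s (M : R) (H : R -> \bar R) : measurable_fun setT H ->
  (forall z, 0 <= H z <= M%:E)%E ->
  (\int[nu]_z H ((z : R) + s)%R <= \int[nu]_z H z + M%:E * translation_gap s)%E.
Proof.
move=> mH HM.
have H0 z : (0 <= H z)%E by have /andP[] := HM z.
have M0 : 0 <= M by have /andP[/le_trans /[apply]] := HM 0; rewrite lee_fin.
have iH (G : R -> \bar R) : measurable_fun setT G -> (forall z, 0 <= G z <= M%:E)%E ->
    nu.-integrable setT G.
  move=> mG GM; apply: (@le_integrable _ _ _ _ _ measurableT _ (cst M%:E)) => //.
    move=> z _; have /andP[G0 GMz] := GM z.
    by rewrite gee0_abs// gee0_abs// lee_fin.
  exact: finite_measure_integrable_cst.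
have mHs : measurable_fun setT (fun z : R => H (z + s)).
  by apply: measurableT_comp => //; exact: measurable_addr.
rewrite (@integral_density _ (measurableTypeR R) R leb nu lambda _ mlambda nu_density
  (iH _ mHs _))//.
rewrite (@integral_density _ (measurableTypeR R) R leb nu lambda _ mlambda nu_density
  (iH _ mH _))//.
rewrite -(ge0_integral_addr s (f := fun z => H z * (lambda z)%:E)%E); last 2 first.
- by apply: emeasurable_funM => //; exact/measurable_EFinP.
- by move=> z; rewrite mule_ge0// lee_fin ltW.
rewrite /translation_gap -ge0_integralZl//; last 2 first.
- apply/measurable_EFinP; exact: measurable_gap.
- by move=> z _; rewrite lee_fin le_max lexx orbT.
rewrite -ge0_integralD//; last 4 first.
- by move=> z _; rewrite mule_ge0// lee_fin ltW.
- apply: emeasurable_funM => //; apply/measurable_EFinP.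
  by apply: measurableT_comp => //; exact: measurable_addr.
- by move=> z _; rewrite mule_ge0// lee_fin// le_max lexx orbT.
- by apply: measurable_funeM; apply/measurable_EFinP; exact: measurable_gap.
apply: ge0_le_integral => //.
- by move=> z _; rewrite mule_ge0// lee_fin ltW.
- by apply: emeasurable_funM => //; exact/measurable_EFinP.
- apply: emeasurable_funD.
    apply: emeasurable_funM => //; apply/measurable_EFinP.
    by apply: measurableT_comp => //; exact: measurable_addr.
  by apply: measurable_funeM; apply/measurable_EFinP; exact: measurable_gap.
move=> z _; have /andP[] := HM (z + s).
case: (H _) => [h| |]//; rewrite !lee_fin => h0 hM.
(* If the density grows from [z] to [z + s], the gap term vanishes and monotonicity suffices;
   otherwise the gap term is the difference itself and [h <= M] pays for it. *)
have [l0|l0] := leP (lambda z - lambda (z + s)) 0.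
  by rewrite mulr0 addr0 ler_wpM2l// -subr_le0.
by rewrite addrC -lerBlDr -mulrBr ler_wpM2r// ltW.
Qed.

(** Continuity gives pointwise convergence to 0. Since [lambda] is positive, the positive part of
    the difference stays below [lambda z], an integrable bound independent of the shift. *)
Lemma cvg_translation_gap (u : R^nat) : u n @[n --> \oo] --> 0 ->
  translation_gap (u n) @[n --> \oo] --> 0%E.
Proof.
move=> u0; rewrite -(integral0 leb setT).
have [|||||_ _] := @dominated_convergence _ _ R leb setT measurableT
  (fun n z => (Num.max (lambda z - lambda ((z : R) + u n)%R) 0)%:E) (cst 0%E)
  (EFin \o lambda) => //.
- by move=> n; apply/measurable_EFinP; exact: measurable_gap.
- apply: aeW => z _; apply: cvg_EFin; first exact: nearW.
  rewrite [X in _ --> X](_ : _ = Num.max (lambda z - lambda z) 0); last first.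
    by rewrite subrr maxxx.
  have uz : z + u n @[n --> \oo] --> z.
    by rewrite -[X in _ --> X]addr0; apply: cvgD => //; exact: cvg_cst.
  apply: (cvg_comp _ _ uz (@continuous_max _ _ (fun w => lambda z - lambda w)
    (cst 0) z _ _)); last exact: cvg_cst.
  by apply: cvgB; [exact: cvg_cst|exact: lambda_cont].
- apply: aeW => z n _; rewrite /= lee_fin ger0_norm ?le_max ?lexx ?orbT//.
  by rewrite ge_max (ltW (lambda_gt0 z)) andbT gerBl ltW.
Qed.

(** A positive density gives [nu] and Lebesgue measure the same null sets, and Lebesgue null sets
    are translation invariant. *)
Lemma null_addr s (S : set R) : measurable S ->
  nu S = 0%E -> nu ((fun z : R => z + s) @^-1` S) = 0%E.
Proof.
move=> mS; rewrite nu_density// => S0.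
have : leb S = 0%E.
  have mlS : measurable_fun S (EFin \o lambda).
    by apply: measurable_funTS; exact/measurable_EFinP.
  have /(ae_eq_integral_abs leb mS mlS)[N [mN N0 SN]] :
      (\int[leb]_(z in S) `|(EFin \o lambda) z| = 0)%E.
    by rewrite -S0; apply: eq_integral => z _ /=; rewrite gtr0_norm.
  apply: (@subset_measure0 _ (measurableTypeR R) R leb S N mS mN _ N0) => z Sz.
  apply: SN => /= /(_ Sz)[].
  by apply/eqP; rewrite gt_eqF.
move=> lS0; rewrite nu_density; last exact: measurable_preimage_addr.
apply: null_set_integral; first exact: measurable_preimage_addr.
  by apply: measurable_funTS; exact/measurable_EFinP.
by rewrite -lS0; exact: lebesgue_measure_addr.
Qed.

End density_translation.

(** * Directed sets of reals *)

Section directed_sets_of_reals.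
Context (R : realType).
Implicit Types (s r t : R) (S : set R).

(* The sign s is 1 for increasing sets and -1 for decreasing ones. *)
Definition directed_set s S := forall x y, S x -> 0 <= s * (y - x) -> S y.

Definition shift_set r S : set R := [set y | S (y + r)].

Lemma norm1_sqr s : `|s| = 1 -> s * s = 1.
Proof. by move=> s1; rewrite -expr2 -real_normK ?num_real// s1 expr1n. Qed.

Lemma norm1P s : `|s| = 1 -> s = 1 \/ s = -1.
Proof.
move=> s1; have : (s - 1) * (s + 1) == 0 by apply/eqP; have := norm1_sqr s1; lra.
by rewrite mulf_eq0 subr_eq0 addr_eq0 => /orP[]/eqP; [left|right].
Qed.

Lemma directed_set_measurable s S : `|s| = 1 -> directed_set s S -> measurable S.
Proof.
move=> s1 dS; apply: is_interval_measurable => x y Sx Sy z /andP[xz zy].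
have [s1'|s1'] := norm1P s1; rewrite s1' in dS.
- by apply: dS Sx _; rewrite mul1r subr_ge0.
- by apply: dS Sy _; rewrite mulN1r opprB subr_ge0.
Qed.

Lemma directed_set_shift s r S : directed_set s S -> directed_set s (shift_set r S).
Proof.
by move=> dS x y Sx xy; apply: dS Sx _; rewrite opprD addrACA subrr addr0.
Qed.

Lemma sub_shift s r S : `|s| = 1 -> 0 <= r -> directed_set s S ->
  S `<=` shift_set (s * r) S.
Proof.
move=> s1 r0 dS y Sy; apply: dS Sy _.
by rewrite addrAC subrr add0r mulrA norm1_sqr// mul1r.
Qed.

(** Among the displacements in [[- r, r]], the extreme one [- (s * r)] already reaches every point
    that the others reach, because [S] is closed in the direction [s]. *)
Lemma minkowski_sum_itv s r S : `|s| = 1 -> 0 <= r -> directed_set s S ->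
  minkowski_sum S `[- r, r] = shift_set (s * r) S.
Proof.
move=> s1 r0 dS; have ss := norm1_sqr s1; apply/seteqP.
split => [_ [x Sx [y yr <-]]|y Sy] /=.
  apply: dS Sx _; move: yr; rewrite /= in_itv/= => yr.
  by have [->|->] := norm1P s1; move: yr => /andP[]; lra.
exists (y + s * r) => //; exists (- (s * r)); last by rewrite addrK.
by rewrite /= in_itv/=; have [->|->] := norm1P s1; lra.
Qed.

(** A proper nonempty directed set is a half-line. The two one-sided implications leave open whether
    its end point [t] belongs to it. *)
Lemma directed_set_cases s S : `|s| = 1 -> directed_set s S ->
  [\/ S = set0, S = setT | exists t, forall y,
    (0 < s * (y - t) -> S y) /\ (S y -> 0 <= s * (y - t))].
Proof.
move=> s1 dS; have ss := norm1_sqr s1.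
have [->|/set0P[y0 Sy0]] := eqVneq S set0; first exact: Or31.
have [->|ST] := pselect (S = setT); first exact: Or32.
have [w Sw] : exists w, ~ S w.
  by apply: contrapT => /forallNP nS; apply: ST; apply/seteqP; split => // z _;
    apply: contrapT; exact: nS.
(* Multiplication by [s] is an involution that turns [S] into an upward closed set [I], so both
   directions use the same infimum, and [t] is its image [s * inf I]. *)
apply: Or33; pose I := [set z | S (s * z)].
have lbI : lbound I (s * w).
  move=> z Iz; rewrite leNgt; apply/negP => zw; apply: Sw; apply: dS Iz _.
  by rewrite mulrBr mulrA ss mul1r subr_ge0 ltW.
have hI : has_inf I.
  by split; [exists (s * y0); rewrite /I /= mulrA ss mul1r|exists (s * w)].
exists (s * inf I) => y; rewrite mulrBr mulrA ss mul1r; split=> [|Sy].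
  rewrite subr_gt0 => /(inf_lt hI.1)[z Iz zy]; apply: dS Iz _.
  by rewrite mulrBr mulrA ss mul1r subr_ge0 ltW.
rewrite subr_ge0; apply: ge_inf; first by exists (s * w).
by rewrite /I /= mulrA ss mul1r.
Qed.

(** The open and the closed slab have the same length, so they pin down the measure of any strip
    lying between them. *)
Lemma lebesgue_measure_slab s t r : `|s| = 1 -> 0 < r ->
  lebesgue_measure [set y | 0 < s * (t - y) < r] = r%:E /\
  lebesgue_measure [set y | 0 <= s * (t - y) <= r] = r%:E.
Proof.
move=> s1 r0; have [->|->] := norm1P s1.
  rewrite (_ : [set y | _ < _ < _] = `]t - r, t[%classic); last first.
    by apply/seteqP; split => y /=; rewrite in_itv/=; lra.
  rewrite (_ : [set y | _ <= _ <= _] = `[t - r, t]%classic); last first.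
    by apply/seteqP; split => y /=; rewrite in_itv/=; lra.
  rewrite !lebesgue_measure_itv/= !lte_fin; have -> : t - r < t by lra.
  by split; rewrite -EFinB opprB addrC subrK.
rewrite (_ : [set y | _ < _ < _] = `]t, t + r[%classic); last first.
  by apply/seteqP; split => y /=; rewrite in_itv/=; lra.
rewrite (_ : [set y | _ <= _ <= _] = `[t, t + r]%classic); last first.
  by apply/seteqP; split => y /=; rewrite in_itv/=; lra.
rewrite !lebesgue_measure_itv/= !lte_fin; have -> : t < t + r by lra.
by split; rewrite -EFinB addrAC subrr add0r.
Qed.

Lemma measurable_slab s t r : `|s| = 1 ->
  measurable [set y | 0 < s * (t - y) < r] /\
  measurable [set y | 0 <= s * (t - y) <= r].
Proof.
move=> s1; split; apply: is_interval_measurable => x y /= Hx Hy z xyz;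
  by have [sE|sE] := norm1P s1; rewrite sE in Hx Hy *; lra.
Qed.

(* Up to its two end points, the strip is an interval of length r ending at t. *)
Lemma lebesgue_measure_shiftD s r t S : `|s| = 1 -> 0 < r -> directed_set s S ->
  (forall y, (0 < s * (y - t) -> S y) /\ (S y -> 0 <= s * (y - t))) ->
  lebesgue_measure (shift_set (s * r) S `\` S) = r%:E /\
  (forall y, (shift_set (s * r) S `\` S) y -> `|t - y| <= r).
Proof.
move=> s1 r0 dS tS; have ss := norm1_sqr s1.
have [m1 m2] := measurable_slab t r s1.
have [l1 l2] := lebesgue_measure_slab t s1 r0.
have mE : measurable (shift_set (s * r) S `\` S).
  apply: measurableD; last exact: directed_set_measurable dS.
  by apply: (directed_set_measurable s1); exact: directed_set_shift.
have sE : shift_set (s * r) S `\` S `<=` [set y | 0 <= s * (t - y) <= r].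
  move=> y [/= /(tS _).2 Sy nSy]; have : ~ 0 < s * (y - t).
    by move=> /(tS _).1.
  by move/negP; rewrite -leNgt; have := ss; nra.
split; last first.
  by move=> y /sE /=; rewrite ler_norml; have [->|->] := norm1P s1; lra.
apply/eqP; rewrite eq_le; apply/andP; split.
  by rewrite -l2; apply: le_measure => //; rewrite inE.
rewrite -l1; apply: le_measure; rewrite ?inE// => y /= ty; split.
  by apply: (tS _).1; have := ss; nra.
by move=> /(tS _).2; lra.
Qed.

End directed_sets_of_reals.

(** * Difference quotients and Minkowski content of half-lines *)

Section directed_set_content.
Context (R : realType) (nu : probability (measurableTypeR R) R) (lambda : R -> R) (M : R).
Hypotheses (nu_density : forall B : set (measurableTypeR R), measurable B ->
       nu B = (\int[lebesgue_measure]_(z in B) (lambda z)%:E)%E)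
  (lambda_cont : continuous lambda) (lambda_gt0 : forall z, 0 < lambda z)
  (lambda_le : forall z, lambda z <= M).
Local Notation leb := (@lebesgue_measure R).

Let mlambda (E : set R) :
  measurable_fun (E : set (measurableTypeR R)) (fun z : R => (lambda z)%:E).
Proof.
by apply: measurable_funTS; apply/measurable_EFinP; exact: continuous_measurable_fun.
Qed.

Let nuK (E : set (measurableTypeR R)) : measurable E -> (fine (nu E))%:E = nu E.
Proof. by move=> mE; rewrite fineK// fin_num_measure. Qed.

Lemma density_measure_ub (E : set R) (r c : R) : measurable E -> leb E = r%:E ->
  (forall y, E y -> lambda y <= c) -> fine (nu E) <= c * r.
Proof.
move=> mE Er Ec; rewrite -lee_fin nuK// nu_density// EFinM -Er.
rewrite -(@integral_cst _ _ _ leb E mE c%:E).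
by apply: ge0_le_integral => // z Ez; rewrite lee_fin ?Ec// ltW.
Qed.

Lemma density_measure_lb (E : set R) (r c : R) : measurable E -> leb E = r%:E ->
  0 <= c -> (forall y, E y -> c <= lambda y) -> c * r <= fine (nu E).
Proof.
move=> mE Er c0 Ec; rewrite -lee_fin nuK// nu_density// EFinM -Er.
rewrite -(@integral_cst _ _ _ leb E mE c%:E).
by apply: ge0_le_integral => // z Ez; rewrite lee_fin Ec.
Qed.

(** For a directed set and [r > 0] this is the quotient under the lower limit in
    [minkowski_content], taken in the reals. *)
Definition shift_quotient (s r : R) (S : set R) : R :=
  (fine (nu (shift_set (s * r) S)) - fine (nu S)) / r.

Lemma fine_measureD (S S' : set R) : measurable S -> measurable S' -> S `<=` S' ->
  fine (nu S') - fine (nu S) = fine (nu (S' `\` S)).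
Proof.
move=> mS mS' SS'; rewrite measureD//; last by rewrite -ge0_fin_numE// fin_num_measure.
by rewrite setIidr// fineB// fin_num_measure.
Qed.

Lemma shift_quotientE s r S : `|s| = 1 -> 0 <= r -> directed_set s S ->
  shift_quotient s r S = fine (nu (shift_set (s * r) S `\` S)) / r.
Proof.
move=> s1 r0 dS; rewrite /shift_quotient fine_measureD//.
- exact: directed_set_measurable dS.
- by apply: (directed_set_measurable s1); exact: directed_set_shift.
- exact: sub_shift.
Qed.

(** The strip gained by the shift is null when [S] is empty or full, and otherwise has length [r]
    and density at most [M]. The bound is uniform in [r] and [S], as dominated convergence over the
    fibres requires. *)
Lemma shift_quotient_bounded s r S : `|s| = 1 -> 0 < r -> directed_set s S ->
  0 <= shift_quotient s r S <= M.
Proof.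
move=> s1 r0 dS; rewrite shift_quotientE//; last exact: ltW.
rewrite divr_ge0 ?fine_ge0//= ?ler_pdivrMr//; last exact: ltW.
have M0 : 0 <= M by rewrite (le_trans _ (lambda_le 0))// ltW.
have [->|->|[t tS]] := directed_set_cases s1 dS.
- by rewrite setD0 measure0/= mulr_ge0// ltW.
- by rewrite setDT measure0/= mulr_ge0// ltW.
have [lE _] := lebesgue_measure_shiftD s1 r0 dS tS.
apply: density_measure_ub => //; apply: measurableD.
  by apply: (directed_set_measurable s1); exact: directed_set_shift.
exact: directed_set_measurable dS.
Qed.

(** The limit is [lambda t] for a half-line with end point [t], because the strip of length [r]
    shrinks to [t] and [lambda] is continuous there. It is 0 for the empty and the full set. *)
Lemma shift_quotient_cvg s S : `|s| = 1 -> directed_set s S ->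
  exists l : R, shift_quotient s r S @[r --> 0^'+] --> l.
Proof.
move=> s1 dS; have [->|->|[t tS]] := directed_set_cases s1 dS.
- exists 0; apply: cvg_near_cst; near=> r.
  by rewrite /shift_quotient (_ : shift_set _ _ = set0)// subrr mul0r.
- exists 0; apply: cvg_near_cst; near=> r.
  by rewrite /shift_quotient (_ : shift_set _ _ = setT)// subrr mul0r.
exists (lambda t); apply/cvgrPdist_le => e e0.
have /cvgrPdist_le/(_ _ e0) := @lambda_cont t.
move=> [d /= d0 td]; near=> r.
have r0 : 0 < r by near: r; exact: nbhs_right_gt.
have rd : r < d by near: r; exact: nbhs_right_lt.
rewrite (shift_quotientE s1 (ltW r0) dS).
have [lE tE] := lebesgue_measure_shiftD s1 r0 dS tS.
set E := shift_set _ _ `\` _ in lE tE *.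
have mE : measurable E.
  apply: measurableD; last exact: directed_set_measurable dS.
  by apply: (directed_set_measurable s1); exact: directed_set_shift.
have lamE y : E y -> `|lambda t - lambda y| <= e.
  by move=> /tE ty; apply: td => /=; exact: le_lt_trans rd.
have ub : fine (nu E) <= (lambda t + e) * r.
  apply: density_measure_ub => // y /lamE; rewrite ler_norml; lra.
have lb : (lambda t - e) * r <= fine (nu E).
  (* [density_measure_lb] asks for a nonnegative constant; when [lambda t - e] is not positive, the
     bound follows from nonnegativity of the measure. *)
  have [te|te] := leP (lambda t - e) 0.
    by rewrite (@le_trans _ _ 0)// ?fine_ge0// mulr_le0_ge0// ltW.
  apply: density_measure_lb => //; first exact: ltW.
  by move=> y /lamE; rewrite ler_norml; lra.
rewrite -ler_pdivlMr// in lb; rewrite -ler_pdivrMr// in ub.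
by rewrite ler_norml; lra.
Unshelve. all: by end_near. Qed.

Lemma shift_quotient_content s S : `|s| = 1 -> directed_set s S ->
  exists l : R, minkowski_content nu S = l%:E /\
    shift_quotient s r S @[r --> 0^'+] --> l.
Proof.
move=> s1 dS; have [l ql] := shift_quotient_cvg s1 dS; exists l; split => //.
have qlE : (shift_quotient s r S)%:E @[r --> 0^'+] --> l%:E.
  by apply: cvg_EFin; [exact: nearW|exact: ql].
apply: cvg_limf_einf; apply: cvg_trans qlE; apply: near_eq_cvg; near=> r.
have r0 : 0 < r by near: r; exact: nbhs_right_gt.
have mS := directed_set_measurable s1 dS.
have mrS := directed_set_measurable s1 (@directed_set_shift _ s (s * r) S dS).
rewrite /= (minkowski_sum_itv s1 (ltW r0) dS) /shift_quotient EFinM EFinB !nuK//.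
by rewrite inver gt_eqF.
Unshelve. all: by end_near. Qed.

Lemma minkowski_content_ge0 s S : `|s| = 1 -> directed_set s S ->
  (0 <= minkowski_content nu S)%E.
Proof.
move=> s1 dS; have [l [-> ql]] := shift_quotient_content s1 dS; rewrite lee_fin.
rewrite -(cvg_lim (@Rhausdorff R) ql); apply: limr_ge; first by apply/cvg_ex; exists l.
near=> r; have r0 : 0 < r by near: r; exact: nbhs_right_gt.
by have /andP[] := shift_quotient_bounded s1 r0 dS.
Unshelve. all: by end_near. Qed.

(** The quotients agree for every [r]: enlarging a directed set amounts to translating it, and the
    translate of the null difference is null by [null_addr]. *)
Lemma minkowski_content_ae s S S' : `|s| = 1 ->
  directed_set s S -> directed_set s S' -> S `<=` S' -> nu (S' `\` S) = 0%E ->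
  minkowski_content nu S = minkowski_content nu S'.
Proof.
move=> s1 dS dS' SS' SS'0.
have eqD (U U' : set R) : measurable U -> measurable U' -> U `<=` U' ->
    nu (U' `\` U) = 0%E -> nu U = nu U'.
  by move=> mU mU' UU' UU'0; rewrite -(setDUK UU') measureU0//; exact: measurableD.
have mS := directed_set_measurable s1 dS.
have mS' := directed_set_measurable s1 dS'.
congr limf_einf; apply/funext => r; congr (_ / _)%E; congr (_ - _)%E; last exact: eqD.
have [r0|r0] := leP 0 r.
  rewrite !(minkowski_sum_itv s1)//; apply: eqD.
  - by apply: (directed_set_measurable s1); exact: directed_set_shift.
  - by apply: (directed_set_measurable s1); exact: directed_set_shift.
  - by move=> y; exact: SS'.
  - exact: (null_addr nu_density lambda_cont lambda_gt0 (s * r)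
      (measurableD mS' mS) SS'0).
(* For negative [r] the interval [[- r, r]] is empty, and so are both Minkowski sums. *)
congr (nu _); apply/seteqP; split => z [x _ [y /= yr _]];
  by exfalso; move: yr; rewrite in_itv/=; lra.
Qed.

End directed_set_content.

(** * Power measures *)

Section power_measure_coordinate.
Context d (T : measurableType d) (R : realType) (P : probability T R) (n : nat).
Local Notation mu := (power_measure P n).
Implicit Types (k : 'I_n) (x : n.-tuple T).

(** The fibre of [A] at [x] along coordinate [k] is the preimage of [A] under [update x k]. *)
Definition update x k (y : T) : n.-tuple T :=
  [tuple if j == k then y else tnth x j | j < n].

Lemma measurable_update k :
  measurable_fun [set: n.-tuple T * T] (fun p => update p.1 k p.2).
Proof.
apply/measurable_fun_tnthP => i.
rewrite (_ : _ \o _ = fun p => if i == k then p.2 else tnth p.1 i); last first.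
  by apply/funext => p /=; rewrite tnth_mktuple.
case: (i == k); first exact: measurable_snd.
by apply: (measurableT_comp (measurable_tnth i)); exact: measurable_fst.
Qed.

Definition box (B : 'I_n -> set T) : set (n.-tuple T) :=
  [set x | forall i, B i (tnth x i)].

Lemma measurable_box (B : 'I_n -> set T) :
  (forall i, measurable (B i)) -> measurable (box B).
Proof.
move=> mB; have -> : box B =
    \bigcap_(i in [set: 'I_n]) ((fun x => tnth x i) @^-1` B i).
  by apply/seteqP; split => x /= h i; [move=> _; exact: h | exact: (h i I)].
apply: fin_bigcap_measurable => [|i _]; first exact: finite_finset.
by rewrite -[X in measurable X]setTI; exact: measurable_tnth.
Qed.

Let measure_box (B : 'I_n -> set T) : (forall i, measurable (B i)) ->
  mu (box B) = (\prod_(i < n) P (B i))%E.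
Proof. exact: power_measure_box. Qed.

Definition boxes : set (set (n.-tuple T)) :=
  [set C | exists2 B : 'I_n -> set T, (forall i, measurable (B i)) & C = box B].

(** Each coordinate is measurable for the sigma-algebra of the boxes, since a cylinder is a box with
    full sides elsewhere. The boxes thus form a generating family on which measures can be
    compared. *)
Lemma measurable_boxesE : measurable = <<s boxes >> :> set (set (n.-tuple T)).
Proof.
apply/seteqP; split; last first.
  apply: smallest_sub; first exact: sigma_algebra_measurable.
  by move=> _ [B mB ->]; exact: measurable_box.
move=> C mC.
have mid : measurable_fun setT (id : g_sigma_algebraType boxes -> n.-tuple T).
  apply/measurable_fun_tnthP => i _ B mB; rewrite setTI; apply: sub_sigma_algebra.
  exists (fun j => if j == i then B else setT) => [j|]; first by case: ifP.
  apply/seteqP; split => [x Bx j|x /(_ i)]; last by rewrite eqxx.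
  by case: ifP => // /eqP ->.
by have := mid measurableT _ mC; rewrite setTI.
Qed.

(** Resampling coordinate [k] independently preserves the law: both measures are finite and agree on
    the boxes, which generate and are stable under intersection. *)
Lemma power_measure_update k (C : set (n.-tuple T)) : measurable C ->
  mu C = (mu \x P)%E ((fun p => update p.1 k p.2) @^-1` C).
Proof.
have muT : (mu setT < +oo)%E by rewrite probability_setT ltry.
move=> mC; pose f (p : n.-tuple T * T) := update p.1 k p.2.
pose fm : {mfun _ >-> _} := HB.pack f
  (isMeasurableFun.Build _ _ _ _ f (measurable_update k)).
apply: (@measure_unique _ R (n.-tuple T) boxes (fun=> setT) measurable_boxesE _ _ _
  mu (pushforward (mu \x P)%E fm) _ _ C mC) => //.
- move=> _ _ [B mB ->] [B' mB' ->]; exists (fun i => B i `&` B' i) => [i|].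
    exact: measurableI.
  by apply/seteqP; split => x /= => [[Bx B'x] i|BB'x]; split => // i;
    have [] := BB'x i.
- by move=> _; exists (fun=> setT) => //; apply/seteqP; split.
- by rewrite bigcup_const//.
- move=> _ [B mB ->]; transitivity (\prod_(i < n) P (B i))%E.
    exact: measure_box.
  (* The discarded coordinate of [x] is unconstrained, hence the full side at [k]; the constraint
     [B k] falls on the fresh sample instead. *)
  transitivity ((mu \x P)%E
      (box (fun j => if j == k then setT else B j) `*` B k)); last first.
    congr ((mu \x P)%E _); apply/seteqP; split => [[x y] /= [Bx By] i|[x y] /= Bxy].
      by rewrite tnth_mktuple; case: ifP => [/eqP ->//|ik]; have := Bx i; rewrite ik.
    split => [i|]; last by have := Bxy k; rewrite tnth_mktuple eqxx.
    by case: ifP => // ik; have := Bxy i; rewrite tnth_mktuple ik.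
  have mBk i : measurable (if i == k then setT else B i) by case: ifP.
  transitivity ((\prod_(i < n) P (if i == k then setT else B i)) * P (B k))%E; last first.
    rewrite product_measure1E//; last exact: measurable_box.
    by congr (_ * _)%E; apply/esym; exact: measure_box.
  rewrite (bigD1 k)//= [in RHS](bigD1 k)//= eqxx.
  rewrite probability_setT mul1e muleC; congr (_ * _)%E.
  by apply: eq_bigr => i /negbTE ->.
Qed.

Lemma measurable_integral_update k (G : n.-tuple T -> \bar R) :
  measurable_fun setT G -> (forall x, 0 <= G x)%E ->
  measurable_fun setT (fun x => \int[P]_y G (update x k y))%E.
Proof.
move=> mG G0.
apply: (measurable_fun_fubini_tonelli_F (fun p => G (update p.1 k p.2))) => //.
by apply: measurableT_comp => //; exact: measurable_update.
Qed.

(** This plays the role of Fubini along an arbitrary coordinate without splitting tuples: the old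
    value of coordinate [k] is overwritten, so averaging over it is harmless. *)
Lemma integral_power_measure_update k (G : n.-tuple T -> \bar R) :
  measurable_fun setT G -> (forall x, 0 <= G x)%E ->
  (\int[mu]_x G x = \int[mu]_x \int[P]_y G (update x k y))%E.
Proof.
move=> mG G0; have mu_k := measurable_update k.
rewrite -[RHS](fubini_tonelli1 (fun p => G (update p.1 k p.2)))//; last first.
  exact: measurableT_comp.
rewrite -[RHS](@ge0_integral_pushforward _ _ _ _ R _ mu_k (mu \x P)%E setT G)//.
by apply: eq_measure_integral => S mS _; exact: power_measure_update.
Qed.

Lemma update_fiberE k (h : T -> T) (C : set (n.-tuple T)) (x : n.-tuple T) :
  [set y | C (update x k (h y))] =
  xsection ((fun p : n.-tuple T * T => update p.1 k (h p.2)) @^-1` C) x.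
Proof. by apply/seteqP; split => y; rewrite /xsection/= inE. Qed.

Let measurable_update_comp k (h : T -> T) (C : set (n.-tuple T)) :
  measurable_fun setT h -> measurable C ->
  measurable ((fun p : n.-tuple T * T => update p.1 k (h p.2)) @^-1` C).
Proof.
move=> mh mC; rewrite -[X in measurable X]setTI.
have mf : measurable_fun [set: n.-tuple T * T] (fun p => (p.1, h p.2)).
  apply: measurable_fun_pair; first exact: measurable_fst.
  by apply: (measurableT_comp mh); exact: measurable_snd.
exact: (measurableT_comp (measurable_update k) mf).
Qed.

Lemma measurable_measure_update k (h : T -> T) (C : set (n.-tuple T)) :
  measurable_fun setT h -> measurable C ->
  measurable_fun setT (fun x => P [set y | C (update x k (h y))]).
Proof.
move=> mh mC; under eq_fun do rewrite update_fiberE.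
by apply: measurable_fun_xsection; exact: measurable_update_comp.
Qed.

Lemma measurable_update_fiber k (C : set (n.-tuple T)) x : measurable C ->
  measurable [set y | C (update x k y)].
Proof.
move=> mC; rewrite (update_fiberE k id); apply: measurable_xsection.
by apply: (@measurable_update_comp k id C).
Qed.

Lemma power_measure_fiber k (C : set (n.-tuple T)) : measurable C ->
  mu C = (\int[mu]_x P [set y | C (update x k y)])%E.
Proof.
move=> mC; rewrite (power_measure_update k)//.
by under [RHS]eq_integral do rewrite (update_fiberE k id).
Qed.

End power_measure_coordinate.

(** * Translation of the first coordinates of a tuple *)

Section partial_translations.
Context (R : realType) (n : nat).
Implicit Types (x : n.-tuple R) (c y : R) (k : nat).

(** As [k] runs from 0 to [n], these vectors lead from no displacement to the full diagonal one, a
    single coordinate at a time. *)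
Definition prefix_vector k c : n.-tuple R := [tuple if (j < k)%N then c else 0 | j < n].

Lemma tuple_add_prefix0 x c : tuple_add x (prefix_vector 0 c) = x.
Proof. by apply: eq_from_tnth => j; rewrite !tnth_mktuple addr0. Qed.

Lemma tuple_add_prefixN x k c :
  tuple_add (tuple_add x (prefix_vector k (- c))) (prefix_vector k c) = x.
Proof.
by apply: eq_from_tnth => j; rewrite !tnth_mktuple; case: ifP => _;
  rewrite ?subrK// !addr0.
Qed.

Lemma update_add_prefix x (k : 'I_n) y c :
  tuple_add (update x k y) (prefix_vector k c) =
  update (tuple_add x (prefix_vector k c)) k y.
Proof.
apply: eq_from_tnth => j; rewrite !tnth_mktuple.
by have [->|//] := eqVneq j k; rewrite ltnn addr0.
Qed.

(** The inequality [j < k] is strict, so coordinate [k] moves under the prefix of length [k.+1] but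
    not under that of length [k]; the extra displacement is absorbed by the resampled value. *)
Lemma update_add_prefixS x (k : 'I_n) y c :
  tuple_add (update x k y) (prefix_vector k.+1 c) =
  tuple_add (update x k (y + c)) (prefix_vector k c).
Proof.
apply: eq_from_tnth => j; rewrite !tnth_mktuple.
have [->|jk] := eqVneq j k; first by rewrite ltnSn ltnn addr0.
by rewrite ltnS ltn_neqAle (_ : val j != val k)//.
Qed.

Lemma measurable_tuple_add (u : n.-tuple R) :
  measurable_fun [set: n.-tuple (measurableTypeR R)] (fun x => tuple_add x u :
    n.-tuple (measurableTypeR R)).
Proof.
apply/measurable_fun_tnthP => i.
rewrite (_ : _ \o _ = fun x : n.-tuple (measurableTypeR R) => (tnth x i : R) + tnth u i);
  last by apply/funext => x /=; rewrite tnth_mktuple.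
apply: (measurableT_comp (measurable_addr (tnth u i))).
exact: (@measurable_tnth _ (measurableTypeR R)).
Qed.

Definition shift_tuple_set (u : n.-tuple R) (A : set (n.-tuple R)) : set (n.-tuple R) :=
  [set x | A (tuple_add x u)].

Lemma measurable_shift_tuple_set (u : n.-tuple R) (A : set (n.-tuple (measurableTypeR R))) :
  measurable A -> measurable (shift_tuple_set u A : set (n.-tuple (measurableTypeR R))).
Proof.
by move=> mA; rewrite -[X in measurable X]setTI; exact: measurable_tuple_add.
Qed.

End partial_translations.

(** * Stability of integrals of bounded functions under partial translations *)

Section power_measure_translation.
Context (R : realType) (nu : probability (measurableTypeR R) R) (lambda : R -> R).
Hypotheses (nu_density : forall B : set (measurableTypeR R), measurable B ->
       nu B = (\int[lebesgue_measure]_(z in B) (lambda z)%:E)%E)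
  (lambda_cont : continuous lambda) (lambda_gt0 : forall z, 0 < lambda z).
Context (n : nat).
Local Notation T := (measurableTypeR R).
Local Notation mu := (power_measure nu n).

(** Induction on the number of moved coordinates: resampling the last one turns its displacement
    into a translation in one variable, which by [integral_addr_le] costs [M] times the gap. *)
Lemma integral_prefix_le (M c : R) (k : nat) (G : n.-tuple T -> \bar R) : 0 <= M ->
  (k <= n)%N -> measurable_fun setT G -> (forall x, 0 <= G x <= M%:E)%E ->
  (\int[mu]_x G (tuple_add x (prefix_vector n k c)) <=
   \int[mu]_x G x + (k%:R * M)%:E * translation_gap lambda c)%E.
Proof.
move=> M0 + mG GM; have G0 x : (0 <= G x)%E by have /andP[] := GM x.
have gap0 := translation_gap_ge0 lambda c.
elim: k => [_|k IH kn].
  by rewrite mul0r mul0e adde0; under eq_integral do rewrite tuple_add_prefix0.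
have mGu u : measurable_fun setT (fun x : n.-tuple T => G (tuple_add x u)).
  by apply: measurableT_comp => //; exact: measurable_tuple_add.
have -> : k = Ordinal kn :> nat by [].
set K := Ordinal kn.
rewrite (integral_power_measure_update nu K)//.
under eq_integral do under eq_integral do rewrite update_add_prefixS.
pose F x := (\int[nu]_y G (tuple_add (update x K y) (prefix_vector n K c)))%E.
have mF : measurable_fun setT F.
  exact: (measurable_integral_update nu K (G := fun z => G (tuple_add z (prefix_vector n K c)))).
have F0 x : (0 <= F x)%E by exact: integral_ge0.
apply: (@le_trans _ _ (\int[mu]_x (F x + M%:E * translation_gap lambda c))%E).
  apply: ge0_le_integral => //.
  - by move=> x _; exact: integral_ge0.
  - have := @measurable_integral_update _ T R nu n K
      (fun z => G (tuple_add z (prefix_vector n K.+1 c))) (mGu _) (fun=> G0 _).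
    by under eq_fun do under eq_integral do rewrite update_add_prefixS.
  - by apply: emeasurable_funD => //; exact: measurable_cst.
  move=> x _; pose H y := G (tuple_add (update x K y) (prefix_vector n K c)).
  apply: (integral_addr_le nu_density lambda_cont lambda_gt0 c (H := H)) => [|z].
    apply: (measurableT_comp (mGu (prefix_vector n K c))).
    have mxy : measurable_fun setT (fun y : T => (x, y)) by exact: pair1_measurable.
    exact: (measurableT_comp (measurable_update K) mxy).
  exact: GM.
rewrite ge0_integralD//; last by move=> x _; rewrite mule_ge0.
rewrite integral_cst//= probability_setT mule1.
rewrite -(@integral_power_measure_update _ T R nu n K
  (fun z => G (tuple_add z (prefix_vector n K c))))//.
apply: (@le_trans _ _ (\int[mu]_x G x + (k%:R * M)%:E * translation_gap lambda c +
  M%:E * translation_gap lambda c)%E).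
  by rewrite leeD2r// IH// ltnW.
rewrite -addeA leeD2l// -ge0_muleDl ?lee_fin ?mulr_ge0//.
by rewrite -EFinD /= -natr1 mulrDl mul1r.
Qed.

(** The error in [integral_prefix_le] depends on [G] only through the bound [M], so the functions
    may vary with [m] while the displacement tends to 0. *)
Lemma cvg_integral_prefix (M : R) (k : nat) (c : R^nat)
    (G : nat -> n.-tuple T -> \bar R) (l : R) : 0 <= M -> (k <= n)%N ->
  (forall m, measurable_fun setT (G m)) -> (forall m x, 0 <= G m x <= M%:E)%E ->
  c m @[m --> \oo] --> 0 ->
  (\int[mu]_x G m x)%E @[m --> \oo] --> l%:E ->
  (\int[mu]_x G m (tuple_add x (prefix_vector n k (c m))))%E @[m --> \oo] --> l%:E.
Proof.
move=> M0 kn mG GM c0 Gl.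
have gapc (u : R^nat) : u m @[m --> \oo] --> 0 ->
    ((k%:R * M)%:E * translation_gap lambda (u m))%E @[m --> \oo] --> 0%E.
  move=> u0; rewrite -[X in _ --> X](mule0 (k%:R * M)%:E); apply: cvgeZl => //.
  exact: cvg_translation_gap nu_density lambda_cont lambda_gt0 _ u0.
have cN0 : (- c m) @[m --> \oo] --> 0 by rewrite -oppr0; exact: cvgN.
have mGu m u : measurable_fun setT (fun x : n.-tuple T => G m (tuple_add x u)).
  exact: (measurableT_comp (mG m) (@measurable_tuple_add R n u)).
apply: (@squeeze_cvge _ _ _ _
  (fun m => \int[mu]_x G m x - (k%:R * M)%:E * translation_gap lambda (- c m))%E _
  (fun m => \int[mu]_x G m x + (k%:R * M)%:E * translation_gap lambda (c m))%E).
- near=> m; apply/andP; split; last first.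
    exact: (@integral_prefix_le M (c m) k (G m) M0 kn (mG m) (GM m)).
  have gapfin : ((k%:R * M)%:E * translation_gap lambda (- c m) \is a fin_num)%E.
    near: m.
    have /fine_cvgP[] := gapc _ cN0.
    by [].
  rewrite leeBlDr//.
  (* The lower bound is the same inequality for the displaced function and the opposite
     displacement; the two displacements cancel. *)
  have := @integral_prefix_le M (- c m) k
    (fun x => G m (tuple_add x (prefix_vector n k (c m)))) M0 kn (mGu _ _) (fun=> GM _ _).
  by under eq_integral do rewrite tuple_add_prefixN.
- rewrite -[X in _ --> X]sube0; apply: cvgeB => //; exact: gapc.
- rewrite -[X in _ --> X]adde0; apply: cvgeD => //; exact: gapc.
Unshelve. all: by end_near. Qed.

End power_measure_translation.

(** * Borel directed sets *)

Section directed_borel_sets.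
Context (R : realType) (nu : probability (measurableTypeR R) R) (lambda : R -> R) (M : R).
Hypotheses (nu_density : forall B : set (measurableTypeR R), measurable B ->
       nu B = (\int[lebesgue_measure]_(z in B) (lambda z)%:E)%E)
  (lambda_cont : continuous lambda) (lambda_gt0 : forall z, 0 < lambda z)
  (lambda_le : forall z, lambda z <= M).
Context (n : nat).
Local Notation T := (measurableTypeR R).
Local Notation mu := (power_measure nu n).

Definition directed_tuple_set (s : R) (A : set (n.-tuple R)) :=
  forall x y, A x -> (forall j, 0 <= s * (tnth y j - tnth x j)) -> A y.

Lemma directed_fiber s (A : set (n.-tuple R)) x (k : 'I_n) :
  directed_tuple_set s A -> directed_set s (fiber A x k).
Proof.
move=> dA y z Ay yz; apply: dA Ay _ => j; rewrite !tnth_mktuple.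
by case: ifP => // _; rewrite subrr mulr0.
Qed.

Context (s : R) (B : set (n.-tuple T)).
Hypotheses (s1 : `|s| = 1) (mB : measurable B) (dB : directed_tuple_set s B).

Let q r (k : 'I_n) x : R := shift_quotient nu s r (fiber B x k).

Let M0 : 0 <= M.
Proof. by rewrite (le_trans _ (lambda_le 0))// ltW. Qed.

Let q_bounded r k x : 0 < r -> (0 <= (q r k x)%:E <= M%:E)%E.
Proof.
move=> r0; rewrite !lee_fin.
exact: (shift_quotient_bounded nu_density lambda_cont lambda_gt0 lambda_le s1 r0
  (directed_fiber dB)).
Qed.

Let measurable_q r k : measurable_fun [set: n.-tuple T] (fun x => (q r k x)%:E).
Proof.
apply/measurable_EFinP; apply: measurable_funM; last exact: measurable_cst.
apply: measurable_funB; apply: measurableT_comp => //.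
  exact: (@measurable_measure_update _ T R nu n k (fun y => (y : R) + s * r) B
    (measurable_addr (s * r)) mB).
exact: (@measurable_measure_update _ T R nu n k id B (@measurable_id _ T setT) mB).
Qed.

(** Disintegrating both measures along coordinate [k] at the same displaced point, one fibre is the
    translate of the other by [s * r], so their measures differ by [r] times the shift quotient. *)
Let step (k : 'I_n) r : 0 < r ->
  mu (shift_tuple_set (prefix_vector n k.+1 (s * r)) B) =
  (mu (shift_tuple_set (prefix_vector n k (s * r)) B) +
   r%:E * \int[mu]_x (q r k (tuple_add x (prefix_vector n k (s * r))))%:E)%E.
Proof.
move=> r0; pose c := s * r.
have mS (j : nat) : measurable (shift_tuple_set (prefix_vector n j c) B).
  exact: measurable_shift_tuple_set.
rewrite (power_measure_fiber nu k (mS k.+1)) (power_measure_fiber nu k (mS k)).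
have mqu : measurable_fun [set: n.-tuple T]
    (fun x => (q r k (tuple_add x (prefix_vector n k c)))%:E).
  exact: (measurableT_comp (measurable_q r k) (@measurable_tuple_add R n _)).
rewrite -ge0_integralZl//; last 2 first.
- by move=> x _; have /andP[] := q_bounded k (tuple_add x (prefix_vector n k c)) r0.
- by rewrite lee_fin ltW.
rewrite -ge0_integralD//; last 3 first.
- exact: (@measurable_measure_update _ T R nu n k id _ (@measurable_id _ T setT) (mS k)).
- move=> x _; apply: mule_ge0; first by rewrite lee_fin ltW.
  by have /andP[] := q_bounded k (tuple_add x (prefix_vector n k c)) r0.
- by apply: measurable_funeM; exact: mqu.
apply: eq_integral => x _.
pose z := tuple_add x (prefix_vector n k c).
have -> : [set y | shift_tuple_set (prefix_vector n k c) B (update x k y)] = fiber B z k.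
  by apply/seteqP; split => y; rewrite /shift_tuple_set /= update_add_prefix.
have -> : [set y | shift_tuple_set (prefix_vector n k.+1 c) B (update x k y)] =
    shift_set c (fiber B z k).
  apply/seteqP; split => y;
    by rewrite /shift_tuple_set /shift_set /= update_add_prefixS update_add_prefix.
have dz := directed_fiber (k := k) (x := z) dB.
have m1 := directed_set_measurable s1 dz.
have m2 := directed_set_measurable s1 (@directed_set_shift _ s c _ dz).
have fE (E : set T) : measurable E -> nu E = (fine (nu E))%:E.
  by move=> mE; rewrite fineK// fin_num_measure.
rewrite (fE _ m1) (fE _ m2) -EFinM -EFinD; congr (_%:E).
by rewrite /q /shift_quotient mulrC divfK ?gt_eqF// addrC subrK.
Qed.

Lemma directed_increment r : 0 < r ->
  mu (shift_tuple_set (prefix_vector n n (s * r)) B) =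
  (mu B + r%:E * \sum_(k < n)
    \int[mu]_x (q r k (tuple_add x (prefix_vector n k (s * r))))%:E)%E.
Proof.
move=> r0.
(* The summands are extended by 0 to all natural indices, so that the telescoping can go by
   induction on a number [m] of moved coordinates while the dimension [n] stays fixed. *)
pose I (j : nat) := if insub j is Some k then
  (\int[mu]_x (q r k (tuple_add x (prefix_vector n k (s * r))))%:E)%E else 0%E.
have IE (k : 'I_n) : I k = (\int[mu]_x (q r k (tuple_add x (prefix_vector n k (s * r))))%:E)%E.
  by rewrite /I valK.
have I0 j : (0 <= I j)%E.
  rewrite /I; case: insub => // k; apply: integral_ge0 => x _.
  by have /andP[] := q_bounded k (tuple_add x (prefix_vector n k (s * r))) r0.
under eq_bigr do rewrite -IE.
have [m] : exists m, m = n by exists n.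
suff H : (m <= n)%N -> mu (shift_tuple_set (prefix_vector n m (s * r)) B) =
    (mu B + r%:E * \sum_(j < m) I j)%E.
  by move=> mn; move: H; rewrite mn => ->.
elim: m => [_|m IH mn].
  rewrite big_ord0 mule0 adde0; congr (mu _).
  by apply/seteqP; split => x; rewrite /shift_tuple_set /= tuple_add_prefix0.
have := step (Ordinal mn) r0; rewrite -(IE (Ordinal mn)) /= => ->.
rewrite IH ?(ltnW mn)// big_ord_recr/= ge0_muleDr ?addeA//.
by apply: sume_ge0 => j _; exact: I0.
Qed.

Lemma directed_set_geometric_influence (k : 'I_n) :
  measurable_fun [set: n.-tuple T] (fun x => minkowski_content nu (fiber B x k)) /\
  exists l : R, (\int[mu]_x minkowski_content nu (fiber B x k))%E = l%:E /\
  forall u : R^nat, (forall m, 0 < u m) -> u m @[m --> \oo] --> 0 ->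
    (\int[mu]_x (q (u m) k x)%:E)%E @[m --> \oo] --> l%:E.
Proof.
have qc x (u : R^nat) : (forall m, 0 < u m) -> u m @[m --> \oo] --> 0 ->
    (q (u m) k x)%:E @[m --> \oo] --> minkowski_content nu (fiber B x k).
  move=> u0 ucvg.
  have [l [-> ql]] := shift_quotient_content nu_density lambda_cont lambda_gt0 s1
    (directed_fiber (k := k) (x := x) dB).
  apply: cvg_EFin; first exact: nearW.
  by move/cvg_at_rightP : ql => /(_ u (conj u0 ucvg)).
(* Along this particular sequence the content is a pointwise limit of measurable quotients, hence
   measurable. *)
have inv0 : (fun m : nat => m.+1%:R^-1 : R) m @[m --> \oo] --> (0 : R).
  exact: cvg_harmonic.
have invgt0 m : 0 < m.+1%:R^-1 :> R by [].
have mc : measurable_fun [set: n.-tuple T] (fun x => minkowski_content nu (fiber B x k)).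
  apply: (emeasurable_fun_cvg (fun m x => (q m.+1%:R^-1 k x)%:E)) => [m|x _].
    exact: measurable_q.
  exact: (qc x _ invgt0 inv0).
split => //.
have DC (u : R^nat) : (forall m, 0 < u m) -> u m @[m --> \oo] --> 0 ->
    mu.-integrable setT (fun x => minkowski_content nu (fiber B x k)) /\
    (\int[mu]_x (q (u m) k x)%:E)%E @[m --> \oo] -->
    (\int[mu]_x minkowski_content nu (fiber B x k))%E.
  move=> u0 ucvg.
  have [||||| int_c _ lim_c] := @dominated_convergence _ _ R mu setT measurableT
    (fun m x => (q (u m) k x)%:E) (fun x => minkowski_content nu (fiber B x k))
    (cst M%:E) => //.
  - by apply: aeW => x _; exact: qc.
  - exact: finite_measure_integrable_cst.
  - apply: aeW => x m _; have := q_bounded k x (u0 m).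
    by case/andP => q0 qM; rewrite gee0_abs.
exists (fine (\int[mu]_x minkowski_content nu (fiber B x k))%E).
have [int_c _] := DC _ invgt0 inv0.
rewrite fineK; last exact: integrable_fin_num.
by split => // u u0 ucvg; have [] := DC u u0 ucvg.
Qed.

(** The increment divided by [r] is a sum of integrals of quotients at displaced points.
    [cvg_integral_prefix] removes the displacement in the limit, and
    [directed_set_geometric_influence] identifies what remains. *)
Lemma directed_borel_limit : exists l : 'I_n -> R,
  (forall k, (\int[mu]_x minkowski_content nu (fiber B x k))%E = (l k)%:E) /\
  ((mu (shift_tuple_set (prefix_vector n n (s * r)) B) - mu B) / r%:E)%E
    @[r --> 0^'+] --> (\sum_(k < n) l k)%:E.
Proof.
have /choice[l lE] : forall k : 'I_n, exists l : R,
    (\int[mu]_x minkowski_content nu (fiber B x k))%E = l%:E /\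
    forall u : R^nat, (forall m, 0 < u m) -> u m @[m --> \oo] --> 0 ->
      (\int[mu]_x (q (u m) k x)%:E)%E @[m --> \oo] --> l%:E.
  by move=> k; have [] := directed_set_geometric_influence k.
exists l; split => [k|]; first by have [] := lE k.
apply/cvge_at_rightP => u [u0 ucvg].
have sucvg : s * u m @[m --> \oo] --> 0.
  by rewrite -[X in _ --> X](mulr0 s); apply: cvgM => //; exact: cvg_cst.
rewrite -sumEFin.
rewrite (_ : (fun m => _) = fun m => (\sum_(k < n)
    \int[mu]_x (q (u m) k (tuple_add x (prefix_vector n k (s * u m))))%:E)%E).
  apply: cvg_nnesum => k _.
    apply: nearW => m; apply: integral_ge0 => x _.
    by have /andP[] := q_bounded k (tuple_add x (prefix_vector n k (s * u m))) (u0 m).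
  apply: (cvg_integral_prefix nu_density lambda_cont lambda_gt0 M0
    (G := fun m x => (q (u m) k x)%:E)) => //.
  - exact/ltnW.
  - by move=> m x; exact: q_bounded.
  - by have [_] := lE k; exact.
apply/funext => m; rewrite directed_increment//.
rewrite addeAC subee ?fin_num_measure// add0e inver gt_eqF//.
rewrite muleAC -EFinM divff ?gt_eqF// mul1e//.
Qed.

(** This is [cvg_integral_prefix] for the indicator of [B], constant in [m], with bound 1 and all
    coordinates moved. *)
Lemma cvg_prefix_translation (c : R^nat) : c m @[m --> \oo] --> 0 ->
  mu (shift_tuple_set (prefix_vector n n (c m)) B) @[m --> \oo] --> mu B.
Proof.
move=> c0; rewrite -[X in _ --> X](fineK (fin_num_measure mu B mB)).
have mI : measurable_fun setT (fun x : n.-tuple T => (\1_B x : R)%:E).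
  by apply/measurable_EFinP; exact: measurable_indic.
rewrite (_ : (fun m => _) = fun m => (\int[mu]_x
    (\1_B (tuple_add x (prefix_vector n n (c m))))%:E)%E); last first.
  apply/funext => m.
  have mS : measurable (shift_tuple_set (prefix_vector n n (c m)) B).
    exact: measurable_shift_tuple_set.
  transitivity (\int[mu]_x
      (\1_(shift_tuple_set (prefix_vector n n (c m)) B) x : R)%:E)%E.
    by rewrite integral_indic// setIT.
  by apply: eq_integral => x _; rewrite !indicE.
apply: (@cvg_integral_prefix R nu lambda nu_density lambda_cont lambda_gt0 n 1 n c
  (fun=> fun x => (\1_B x)%:E)) => //.
- by move=> _ x; rewrite !lee_fin indicE; case: (_ \in _); rewrite ?lexx ?ler01.
- rewrite integral_indic// setIT fineK ?fin_num_measure//; exact: cvg_cst.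
Qed.

End directed_borel_sets.

(** * Completion and Borel approximation *)

Section completed_measure.
Context d (T : measurableType d) (R : realType) (mu : {measure set T -> \bar R}).
Local Notation cmu := (@completed_measure_extension _ T R mu).
Local Notation cT := (caratheodory_type (mu^*)%mu).

Lemma completed_measure_sandwich (A B C : set T) : measurable B -> measurable C ->
  B `<=` A -> A `<=` C -> mu B = mu C -> cmu A = mu B.
Proof.
move=> mB mC BA AC BC; rewrite /completed_measure_extension.
apply/eqP; rewrite eq_le; apply/andP; split.
  by rewrite BC -(measurable_mu_extE mu mC); exact: le_mu_ext.
by rewrite -(measurable_mu_extE mu mB); exact: le_mu_ext.
Qed.

(** Completeness makes [f] measurable because it agrees with [g] off a null set. The identity from
    the completed space to [T] is measurable and pushes the completed measure forward to [mu], which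
    transfers the integral of [g]. *)
Lemma completed_integral_ae (f g : T -> \bar R) (N : set T) :
  measurable_fun setT g -> (forall x, 0 <= g x)%E ->
  measurable N -> mu N = 0%E -> (forall x, ~ N x -> f x = g x) ->
  (\int[cmu]_x f x = \int[mu]_x g x)%E.
Proof.
move=> mg g0 mN N0 fg.
pose j : cT -> T := id.
have mj : measurable_fun setT j.
  by move=> _ S mS; rewrite setTI; exact: caratheodory_measurable_mu_ext.
have mgc : measurable_fun setT (g : cT -> \bar R) by exact: (measurableT_comp mg mj).
have cae : ae_eq cmu setT (g : cT -> \bar R) f.
  exists N; split; first exact: caratheodory_measurable_mu_ext.
    by rewrite /completed_measure_extension; rewrite -[RHS]N0; exact: measurable_mu_extE.
  by move=> x /= gf; apply: contrapT => /fg fgx; apply: gf => _; rewrite fgx.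
have mfc : measurable_fun setT (f : cT -> \bar R).
  apply: (ae_measurable_fun _ cae mgc); exact: measure_is_complete_caratheodory.
rewrite -(@ae_eq_integral _ cT R cmu setT f g measurableT mgc mfc cae).
have := @ge0_integral_pushforward _ _ cT T R j mj cmu setT g measurableT mg (fun x _ => g0 x).
move=> /= <-; apply: eq_measure_integral => S mS _.
exact: measurable_mu_extE.
Qed.

End completed_measure.

(** * Borel hulls of monotone sets and the limit in general *)

Section borel_approximation.
Context (R : realType) (nu : probability (measurableTypeR R) R) (lambda : R -> R) (M : R).
Hypotheses (nu_density : forall B : set (measurableTypeR R), measurable B ->
       nu B = (\int[lebesgue_measure]_(z in B) (lambda z)%:E)%E)
  (lambda_cont : continuous lambda) (lambda_gt0 : forall z, 0 < lambda z)
  (lambda_le : forall z, lambda z <= M).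
Context (n : nat).
Local Notation T := (measurableTypeR R).
Local Notation mu := (power_measure nu n).
Implicit Types (s r : R) (A B : set (n.-tuple T)).

Lemma tuple_minkowski_sum_cube s r A : `|s| = 1 -> 0 <= r -> directed_tuple_set s A ->
  tuple_minkowski_sum A (cube r) = shift_tuple_set (prefix_vector n n (s * r)) A.
Proof.
move=> s1 r0 dA; apply/seteqP; split => [_ [x Ax [y yr <-]]|x Ax].
  apply: dA Ax _ => j; rewrite !tnth_mktuple ltn_ord.
  have := yr j; rewrite in_itv/= => yj.
  by have [->|->] := norm1P s1; move: yj => /andP[]; lra.
exists (tuple_add x (prefix_vector n n (s * r))) => //.
exists (prefix_vector n n (- (s * r))).
  move=> j; rewrite tnth_mktuple ltn_ord in_itv/=.
  by have [->|->] := norm1P s1; lra.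
by have := tuple_add_prefixN x n (- (s * r)); rewrite opprK.
Qed.

(** Rational corners make the union of orthants countable, hence Borel, whatever [A] is. *)
Definition rational_hull s A : set (n.-tuple T) :=
  \bigcup_(q : n.-tuple rat) [set x | A [tuple ratr (tnth q j) | j < n] /\
    forall j, 0 <= s * (tnth x j - ratr (tnth q j))].

Lemma measurable_rational_hull s A : measurable (rational_hull s A).
Proof.
apply: countable_bigcupT_measurable => [|q]; first exact: countableP.
have [Aq|Aq] := pselect (A [tuple ratr (tnth q j) | j < n]); last first.
  by rewrite [X in measurable X](_ : _ = set0)//; apply/seteqP; split => // x [].
rewrite [X in measurable X](_ : _ =
  box (fun j => [set y : T | 0 <= s * ((y : R) - ratr (tnth q j))])).
  apply: measurable_box => j; rewrite -[X in measurable X]setTI.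
  apply: (@measurable_fun_ler _ T R setT (fun=> 0)
    (fun y : T => s * ((y : R) - ratr (tnth q j)))) => //.
  apply: measurable_funM; first exact: measurable_cst.
  exact: (measurable_addr (- ratr (tnth q j))).
by apply/seteqP; split => x; [case|].
Qed.

Lemma rational_hull_sub s A : directed_tuple_set s A -> rational_hull s A `<=` A.
Proof.
by move=> dA x [q _ [Aq qx]]; apply: dA Aq _ => j; rewrite tnth_mktuple.
Qed.

Lemma directed_rational_hull s A : directed_tuple_set s (rational_hull s A).
Proof.
move=> x y [q _ [Aq qx]] xy; exists q => //; split => // j.
by rewrite -(subrK (tnth x j) (tnth y j)) -addrA mulrDr addr_ge0.
Qed.

Lemma sub_shift_rational_hull s e A : `|s| = 1 -> 0 < e -> directed_tuple_set s A ->
  A `<=` shift_tuple_set (prefix_vector n n (s * e)) (rational_hull s A).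
Proof.
move=> s1 e0 dA x Ax.
(* In each coordinate a rational is chosen between [x] and its displacement by [s * e]: the first
   inequality puts the corner in [A], the second puts the displaced point in its orthant. *)
have /choice[f fP] : forall j : 'I_n, exists q : rat,
    0 <= s * (ratr q - tnth x j) /\ 0 <= s * (tnth x j + s * e - ratr q).
  move=> j; have [->|->] := norm1P s1.
    have [q] : exists q, ratr q \in `](tnth x j : R), tnth x j + e[.
      by apply: rat_in_itvoo; rewrite ltrDl.
    by rewrite in_itv/= => /andP[? ?]; exists q; lra.
  have [q] : exists q, ratr q \in `](tnth x j : R) - e, tnth x j[.
    by apply: rat_in_itvoo; rewrite ltrBlDr ltrDl.
  by rewrite in_itv/= => /andP[? ?]; exists q; lra.
exists [tuple f j | j < n] => //; split => [|j].
  by apply: dA Ax _ => j; rewrite !tnth_mktuple; have [] := fP j.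
by rewrite !tnth_mktuple ltn_ord; have [] := fP j.
Qed.

(** The envelope is the intersection of the diagonal shifts of [B] by [1 / (m + 1)]. Its measure is
    at most that of each shift, and these tend to [mu B] by [cvg_prefix_translation]. *)
Lemma borel_envelope s A B : `|s| = 1 -> measurable B ->
  (forall e, 0 < e -> A `<=` shift_tuple_set (prefix_vector n n (s * e)) B) ->
  B `<=` A ->
  exists C : set (n.-tuple T), [/\ measurable C, A `<=` C & mu (C `\` B) = 0%E].
Proof.
move=> s1 mB AB BA.
pose F m := shift_tuple_set (prefix_vector n n (s * m.+1%:R^-1)) B.
have mF m : measurable (F m) by exact: measurable_shift_tuple_set.
have mC : measurable (\bigcap_m F m) by apply: bigcap_measurable => //; exists 0%N.
have AC : A `<=` \bigcap_m F m by move=> x Ax m _; exact: AB.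
exists (\bigcap_m F m); split => //.
have BC : B `<=` \bigcap_m F m by exact: subset_trans AC.
suff CB : (mu (\bigcap_m F m) <= mu B)%E.
  rewrite measureD//; last by rewrite -ge0_fin_numE// fin_num_measure.
  rewrite setIidr//; apply/eqP; rewrite eq_le subre_ge0 ?fin_num_measure//.
  by rewrite le_measure ?inE// andbT leeBlDr ?fin_num_measure// add0e.
have inv0 : s * m.+1%:R^-1 @[m --> \oo] --> (0 : R).
  rewrite -[X in _ --> X](mulr0 s); apply: cvgM; first exact: cvg_cst.
  exact: cvg_harmonic.
have lF := cvg_prefix_translation nu_density lambda_cont lambda_gt0 mB inv0.
rewrite -(cvg_lim _ lF)//; apply: lime_ge; first by apply/cvg_ex; eexists; exact: lF.
apply: nearW => m; apply: le_measure; rewrite ?inE//; first exact: mF.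
exact: (@bigcap_inf _ _ m).
Qed.

Lemma completed_power_measure_envelope s A B : `|s| = 1 -> measurable B ->
  (forall e, 0 < e -> A `<=` shift_tuple_set (prefix_vector n n (s * e)) B) ->
  B `<=` A -> completed_power_measure nu n A = mu B.
Proof.
move=> s1 mB AB BA; have [C [mC AC CB]] := borel_envelope s1 mB AB BA.
apply: (completed_measure_sandwich mB mC BA AC).
rewrite -(setDUK (subset_trans BA AC)) measureU//; last 2 first.
- exact: measurableD.
- by rewrite setDE setICA setICr setI0.
by rewrite -[LHS]adde0; congr (_ + _)%E; exact/esym/CB.
Qed.

(** Translations commute, so the displaced hull approximates the displaced set exactly as the hull
    approximates [A], and the envelope argument applies to the pair. *)
Lemma directed_completed_measure s (u : n.-tuple R) A : `|s| = 1 -> directed_tuple_set s A ->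
  completed_power_measure nu n (shift_tuple_set u A) =
  mu (shift_tuple_set u (rational_hull s A)).
Proof.
move=> s1 dA; apply: (completed_power_measure_envelope s1).
- by apply: measurable_shift_tuple_set; exact: measurable_rational_hull.
- move=> e e0 x /(sub_shift_rational_hull s1 e0 dA).
  rewrite /shift_tuple_set /=; congr (rational_hull s A _).
  by apply: eq_from_tnth => j; rewrite !tnth_mktuple addrAC.
- by move=> x; exact: rational_hull_sub.
Qed.

Lemma directed_geometric_influence s A (k : 'I_n) : `|s| = 1 -> directed_tuple_set s A ->
  measurable_fun [set: n.-tuple T]
    (fun x => minkowski_content nu (fiber (rational_hull s A) x k)) ->
  geometric_influence nu A k =
  (\int[mu]_x minkowski_content nu (fiber (rational_hull s A) x k))%E.
Proof.
move=> s1 dA mcontent; set B := rational_hull s A.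
have mB : measurable B by exact: measurable_rational_hull.
have BA : B `<=` A by exact: rational_hull_sub.
have dB : directed_tuple_set s B by exact: directed_rational_hull.
have [C [mC AC CB]] : exists C : set (n.-tuple T),
    [/\ measurable C, A `<=` C & mu (C `\` B) = 0%E].
  by apply: (borel_envelope s1 mB) => // e e0; exact: sub_shift_rational_hull.
have mCB : measurable (C `\` B) by exact: measurableD.
pose h x := nu [set y | (C `\` B) (update x k y)].
have mh : measurable_fun [set: n.-tuple T] h.
  exact: (@measurable_measure_update _ T R nu n k id _ (@measurable_id _ T setT) mCB).
(* The average over [x] of the fibre measures of [C] minus [B] is the measure of this null set, so
   almost every fibre is null; [minkowski_content_ae] then applies off [N]. *)
have [N [mN N0 hN]] : ae_eq mu setT h (cst 0%E).
  apply/(ae_eq_integral_abs mu measurableT mh).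
  rewrite -[RHS]CB (power_measure_fiber nu k mCB).
  by apply: eq_integral => x _; rewrite gee0_abs.
apply: (completed_integral_ae mcontent _ mN N0) => x.
  exact: (minkowski_content_ge0 nu_density lambda_cont lambda_gt0 lambda_le s1
    (directed_fiber dB)).
move=> Nx; have hx : h x = 0%E.
  by apply: contrapT => hx; apply: Nx; apply: hN => /= /(_ I).
have dAx := directed_fiber (k := k) (x := x) dA.
have dBx := directed_fiber (k := k) (x := x) dB.
apply/esym; apply: (minkowski_content_ae nu_density lambda_cont lambda_gt0 s1 dBx dAx).
  by move=> y; exact: BA.
apply: (@subset_measure0 _ T R nu _ [set y | (C `\` B) (update x k y)]) => //.
- by apply: measurableD; exact: (directed_set_measurable s1).
- exact: (@measurable_update_fiber _ T n k _ x mCB).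
- by move=> y [Ay By]; split => //; exact: AC.
Qed.

Lemma directed_limit s A : `|s| = 1 -> directed_tuple_set s A ->
  ((completed_power_measure nu n (tuple_minkowski_sum A (cube r))
    - completed_power_measure nu n A) / r%:E)%E @[r --> 0^'+] -->
  (\sum_(i < n) geometric_influence nu A i)%E.
Proof.
move=> s1 dA; set B := rational_hull s A.
have mB : measurable B by exact: measurable_rational_hull.
have dB : directed_tuple_set s B by exact: directed_rational_hull.
have [l [lE lim_l]] := directed_borel_limit nu_density lambda_cont lambda_gt0 lambda_le
  s1 mB dB.
rewrite (eq_bigr (fun k => (l k)%:E)); last first.
  move=> k _; rewrite -lE; apply: directed_geometric_influence => //.
  by have [] := directed_set_geometric_influence nu_density lambda_cont lambda_gt0 lambda_le
    s1 mB dB k.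
rewrite sumEFin; apply: cvg_trans lim_l; apply: near_eq_cvg; near=> r.
have r0 : 0 < r by near: r; exact: nbhs_right_gt.
(* The measure of [A] itself is the case of zero displacement of [directed_completed_measure]. *)
have shift0 E : shift_tuple_set (prefix_vector n 0 0) E = E.
  by apply/seteqP; split => x; rewrite /shift_tuple_set /= tuple_add_prefix0.
have AB : completed_power_measure nu n A = mu B.
  by have := directed_completed_measure (prefix_vector n 0 0) s1 dA; rewrite !shift0.
by rewrite (tuple_minkowski_sum_cube s1 (ltW r0) dA) AB (directed_completed_measure _ s1 dA).
Unshelve. all: by end_near. Qed.

End borel_approximation.

(** * Bound on the density and conclusion *)

Lemma continuous_vanishing_ubound (R : realType) (f : R -> R) :
  continuous f -> f z @[z --> +oo] --> 0 -> f z @[z --> -oo] --> 0 ->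
  exists M, forall z, f z <= M.
Proof.
move=> cf fp fn.
have [a fa] : exists a, forall z, a <= z -> f z <= 1.
  have /cvgrPdist_le/(_ 1 ltr01)[a [_ fa]] := fp.
  exists (a + 1) => z az; have := fa z.
  by rewrite /= sub0r normrN ler_norml => /(_ ltac:(lra)) /andP[].
have [b fb] : exists b, forall z, z <= b -> f z <= 1.
  have /cvgrPdist_le/(_ 1 ltr01)[b [_ fb]] := fn.
  exists (b - 1) => z zb; have := fb z.
  by rewrite /= sub0r normrN ler_norml => /(_ ltac:(lra)) /andP[].
have [ab|ab] := leP b a; last first.
  exists 1 => z; have [/fa//|za] := leP a z; apply: fb; lra.
(* Outside the compact interval from [b] to [a] the bound is 1; inside, the extreme value theorem
   supplies the maximum [f c]. *)
have [c _ fc] := @EVT_max R f b a ab (continuous_subspaceT cf).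
exists (Num.max 1 (f c)) => z; rewrite le_max.
have [/fa->//|za] := leP a z; have [/fb->//|bz] := leP z b.
by rewrite fc ?orbT// in_itv/= !ltW.
Qed.

Theorem proposition1p3 (R : realType) (nu : probability (measurableTypeR R) R)
    (lambda : R -> R)
    (nu_density : forall B : set (measurableTypeR R), measurable B ->
       nu B = (\int[lebesgue_measure]_(z in B) (lambda z)%:E)%E)
    (lambda_derivable : forall z, derivable lambda z 1)
    (lambda_C1 : continuous (derive1 lambda))
    (lambda_gt0 : forall z, 0 < lambda z)
    (lambda_pinfty : lambda z @[z --> +oo] --> 0)
    (lambda_ninfty : lambda z @[z --> -oo] --> 0)
    (lambda'_bounded : bounded_fun (derive1 lambda))
    (n : nat) (A : set (n.-tuple R))
    (A_monotone : monotone_increasing A \/ monotone_decreasing A) :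
  ((completed_power_measure nu n (tuple_minkowski_sum A (cube r))
    - completed_power_measure nu n A) / r%:E)%E @[r --> 0^'+] -->
  (\sum_(i < n) geometric_influence nu A i)%E.
Proof.
have lambda_cont : continuous lambda.
  by move=> z; apply: differentiable_continuous; exact/derivable1_diffP.
have [M lambda_le] := continuous_vanishing_ubound lambda_cont lambda_pinfty lambda_ninfty.
case: A_monotone => monoA.
  apply: (@directed_limit R nu lambda M nu_density lambda_cont lambda_gt0 lambda_le n 1).
    exact: normr1.
  by move=> x y Ax xy; apply: monoA Ax _ => j; have := xy j; rewrite mul1r subr_ge0.
apply: (@directed_limit R nu lambda M nu_density lambda_cont lambda_gt0 lambda_le n (- 1)).
  by rewrite normrN normr1.
by move=> x y Ax xy; apply: monoA Ax _ => j; have := xy j; rewrite mulN1r opprB subr_ge0.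
Qed.
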